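(* Let $(P,\omega)$ be a canonically labeled sign-graded poset with $p$ elements and rank $r$. Then the Charney–Davis quantity $CD(P)=(-1)^{(p-1-r)/2}W(P,\omega;-1)$ is equal to the number of reverse alternating permutations in $\mathcal{L}(P,\omega)$ all of whose components have an odd number of letters.
   Context: $\omega:P\to\{1,\dots,p\}$ is a bijection; write $x\prec y$ if $y$ covers $x$, and $\epsilon(x,y)=1$ if $\omega(x)<\omega(y)$, $-1$ otherwise. $(P,\omega)$ is sign-graded of rank $r$ if $\sum_{i=1}^n\epsilon(x_{i-1},x_i)=r$ for every maximal chain $x_0\prec\cdots\prec x_n$; then each principal ideal $\Lambda_z=\{w\le z\}$ is likewise graded and $\rho(z)$ denotes its rank (the $\epsilon$-weight of any saturated chain from a minimal element to $z$). $\omega$ is canonical if $\rho$ takes values in $\{0,1\}$ and $\rho(x)<\rho(y)$ implies $\omega(x)<\omega(y)$. $\mathcal{L}(P,\omega)$ is the set of permutations $\omega(x_1)\cdots\omega(x_p)$ with $x_1,\dots,x_p$ a linear extension of $P$, and $W(P,\omega;t)=\sum_{\pi\in\mathcal{L}(P,\omega)}t^{\mathrm{des}(\pi)}$, $\mathrm{des}(\pi)=\#\{i:\pi_i>\pi_{i+1}\}$. (When $p-1-r$ is odd, $W(P,\omega;-1)=0$ and $CD(P)$ is $0$.) A permutation $\pi=\pi_1\cdots\pi_n$ is reverse alternating if $\pi_1<\pi_2>\pi_3<\cdots$. The components of $\pi\in\mathcal{L}(P,\omega)$ are the words $w_0,\dots,w_k$ in the factorization $\pi=w_0w_1\cdots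 w_k$ into maximal consecutive subwords such that all letters $a$ of a given $w_i$ have the same value $\rho(\omega^{-1}(a))$. *)

(* Defs.v *)
From Stdlib Require Import ClassicalEpsilon.
From mathcomp Require Import all_boot all_order all_algebra.
Set Implicit Arguments. Unset Strict Implicit. Unset Printing Implicit Defensive.
Import Order.TTheory GRing.Theory Num.Theory.

Section LabeledPoset.
Variables (T : finType) (le : rel T) (omega : T -> nat).

Definition is_poset : Prop :=
  [/\ reflexive le, antisymmetric le & transitive le].

Definition is_labeling : Prop :=
  injective omega /\ (forall x, 1 <= omega x <= #|T|)%N.

Definition plt (x y : T) : bool := (x != y) && le x y.

Definition covers (x y : T) : bool :=
  plt x y && ~~ [exists z, plt x z && plt z y].

Definition minimal (x : T) : bool := [forall y, le y x ==> (y == x)].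
Definition maximal (x : T) : bool := [forall y, le x y ==> (y == x)].

Local Open Scope ring_scope.

Definition eps (x y : T) : int := if (omega x < omega y)%N then 1 else -1.

Fixpoint weight (x : T) (s : seq T) : int :=
  match s with
  | [::] => 0
  | y :: s' => eps x y + weight y s'
  end.

Definition maximal_chain (x0 : T) (s : seq T) : bool :=
  [&& minimal x0, path covers x0 s & maximal (last x0 s)].

Definition sign_graded (r : int) : Prop :=
  forall x0 s, maximal_chain x0 s -> weight x0 s = r.

Definition rho_of (z : T) (k : int) : Prop :=
  exists x0 s, [/\ minimal x0, path covers x0 s & last x0 s = z] /\ weight x0 s = k.

(* rho(z); well defined when (P, omega) is sign-graded *)
Definition rho (z : T) : int := epsilon (inhabits 0) (rho_of z).

Definition canonical : Prop :=
  (forall x, rho x = 0 \/ rho x = 1) /\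
  (forall x y, rho x < rho y -> (omega x < omega y)%N).

Definition is_linext (t : #|T|.-tuple T) : bool :=
  uniq t && [forall i, forall j, plt (tnth t i) (tnth t j) ==> (i < j)%N].

Definition Lperm : seq (seq nat) :=
  undup (map (fun t : #|T|.-tuple T => map omega t)
             (filter is_linext (enum {: #|T|.-tuple T}))).

Definition des (pi : seq nat) : nat :=
  count (fun i => nth 0%N pi i.+1 < nth 0%N pi i)%N (iota 0 (size pi).-1).

Definition W : {poly int} := \sum_(pi <- Lperm) 'X^(des pi).

Definition CD (r : int) : int :=
  let m := absz ((#|T|%:Z - 1 - r)%R : int) in
  if odd m then 0 else (-1) ^+ (m %/ 2)%N * W.[-1].

Definition rho_letter (a : nat) : int :=
  if [pick x | omega x == a] is Some x then rho x else 0.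

End LabeledPoset.

Fixpoint components (f : nat -> int) (s : seq nat) : seq (seq nat) :=
  match s with
  | [::] => [::]
  | a :: s' =>
    match components f s' with
    | (b :: w) :: ws =>
        if f a == f b then (a :: b :: w) :: ws else [:: a] :: (b :: w) :: ws
    | _ => [:: [:: a]]
    end
  end.

Definition rev_alternating (pi : seq nat) : bool :=
  all (fun i => if odd i then (nth 0 pi i.+1 < nth 0 pi i)%N
                else (nth 0 pi i < nth 0 pi i.+1)%N)
      (iota 0 (size pi).-1).

Definition odd_components (f : nat -> int) (pi : seq nat) : bool :=
  all (fun w => odd (size w)) (components f pi).

(* Main.v *)
(** A valley-hopping involution in the style of Foata and Strehl. Say that a letter [y]
    is inside [x] if [rho y = rho x] and [y] is smaller than [x] when [rho x = 0], larger
    when [rho x = 1]. For neighbours [x y] of a word in [L(P, omega)], the word descends at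
    [x y] iff exactly one of "[y] is inside [x]", "[rho x = 1]" holds, because the labeling
    is canonical. If exactly one neighbour of [x] is inside [x], moving [x] across the
    maximal run of letters inside [x] next to it exchanges the two sides of [x] and leaves
    all other letters as they were, so it flips the parity of the number of descents. The
    run lies in one component, hence is an antichain together with [x], and the new word is
    again a linear extension. Hopping the first such [x] of the poset is therefore a
    sign-reversing involution. At its fixed points the words are reverse alternating and
    components begin and end with a letter having no neighbour inside it, which makes all
    components odd; the number of descents is then [(p - 1 - r) / 2]. *)

Require Import Defs.
From mathcomp Require Import all_boot all_order all_algebra.
From mathcomp Require Import zify.
From Stdlib Require Import ClassicalEpsilon.
Set Implicit Arguments. Unset Strict Implicit. Unset Printing Implicit Defensive.
Import Order.TTheory GRing.Theory Num.Theory.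

(** * Hops in words over an abstract relation [B] *)

Section Hop.
Variables (X : eqType) (B : rel X).
Hypotheses (Birr : irreflexive B) (Btrans : transitive B).
Hypothesis Bforest : forall x y z, B x z -> B y z -> x != y -> B x y || B y x.

(* The value [false] at the end of a word replaces the sentinels (infinite letters) usually
   put around a permutation for valley hopping. *)
Definition head_in (x : X) (v : seq X) : bool := if v is y :: _ then B x y else false.

Definition right_in (s : seq X) (x : X) : bool := head_in x (drop (index x s).+1 s).

Definition left_in (s : seq X) (x : X) : bool := head_in x (rev (take (index x s) s)).

Definition hop_right (x : X) (u v : seq X) : seq X :=
  let n := find (predC (B x)) v in u ++ take n v ++ x :: drop n v.

(** A hop to the left is a hop to the right in the reversed word. *)
Definition hop (x : X) (s : seq X) : seq X :=
  let u := take (index x s) s in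
  let v := drop (index x s).+1 s in
  if right_in s x then hop_right x u v else rev (hop_right x (rev v) (rev u)).

(** A hop to the right from [s] to [s']; a hop to the left is the converse relation. The conditions
    on [u] and [v] keep letters inside [x] away from both ends of the block. *)
Variant hopped (x : X) (s s' : seq X) : Prop :=
  Hopped u b v of s = u ++ x :: b ++ v & s' = u ++ b ++ x :: v
    & b != [::] & all (B x) b & ~~ head_in x (rev u) & ~~ head_in x v.

Lemma take_index_cat (x : X) u v : x \notin u -> take (index x (u ++ x :: v)) (u ++ x :: v) = u.
Proof. by move=> xu; rewrite index_cat (negbTE xu) /= eqxx addn0 take_size_cat. Qed.

Lemma drop_index_cat (x : X) u v : x \notin u -> drop (index x (u ++ x :: v)).+1 (u ++ x :: v) = v.
Proof.
move=> xu; rewrite index_cat (negbTE xu) /= eqxx addn0 -cat_rcons drop_size_cat //.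
by rewrite size_rcons.
Qed.

Lemma right_in_cat (x : X) u v : x \notin u -> right_in (u ++ x :: v) x = head_in x v.
Proof. by move=> xu; rewrite /right_in drop_index_cat. Qed.

Lemma left_in_cat (x : X) u v : x \notin u -> left_in (u ++ x :: v) x = head_in x (rev u).
Proof. by move=> xu; rewrite /left_in take_index_cat. Qed.

Lemma uniq_notin_cat x (u v : seq X) : uniq (u ++ x :: v) -> (x \notin u) /\ (x \notin v).
Proof.
rewrite cat_uniq /= negb_or => /and3P[_ /andP[xu _] /andP[xv _]].
by split.
Qed.

Lemma right_in_rev s x : uniq s -> x \in s -> right_in (rev s) x = left_in s x.
Proof.
move=> us xs; case/splitPr: xs us => u v us.
have [xu xv] := uniq_notin_cat us.
by rewrite left_in_cat // rev_cat rev_cons cat_rcons right_in_cat // mem_rev.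
Qed.

(** The shape is symmetric under reversal combined with exchange of the two words, so facts about
    left neighbours follow from those about right neighbours. *)
Lemma hopped_rev x s s' : hopped x s s' -> hopped x (rev s') (rev s).
Proof.
case=> u b v -> -> b0 bB hu hv; apply: (@Hopped _ _ _ (rev v) (rev b) (rev u)).
- by rewrite !rev_cat rev_cons cat_rcons -catA.
- by rewrite rev_cat rev_cons rev_cat cat_rcons -catA.
- by rewrite -size_eq0 size_rev size_eq0.
- by rewrite all_rev.
- by rewrite revK.
- by [].
Qed.

Lemma hopped_perm x s s' : hopped x s s' -> perm_eq s s'.
Proof.
case=> u b v -> -> _ _ _ _; rewrite perm_cat2l -cat_rcons -cat_cons perm_cat2r.
by rewrite perm_sym perm_rcons.
Qed.

Lemma hopped_self x s s' : uniq s -> hopped x s s' ->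
  [/\ right_in s x, ~~ left_in s x, ~~ right_in s' x & left_in s' x].
Proof.
move=> us H; have := us; rewrite (perm_uniq (hopped_perm H)).
case: H us => u b v -> -> b0 bB hu hv us us'.
have [xu _] := uniq_notin_cat us.
move: us'; rewrite catA => us'; have [xub _] := uniq_notin_cat us'.
rewrite !right_in_cat // !left_in_cat //; split=> //.
  by case: b b0 bB {us us' xub} => [|y b] //= _ /andP[].
rewrite rev_cat; case: (lastP b) b0 bB {us us' xub} => [|b' y] //= _.
by rewrite all_rcons rev_rcons => /andP[].
Qed.

Lemma Basym x y : B x y -> B y x = false.
Proof. by move=> xy; apply/negbTE/negP => yx; have := Btrans xy yx; rewrite Birr. Qed.

(** Besides [x], only the last letters of [u] and of [b] get a new right neighbour. *)
Lemma hopped_right x s s' y : uniq s -> hopped x s s' -> y \in s -> y != x ->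
  right_in s' y = right_in s y.
Proof.
move=> us H; have := us; rewrite (perm_uniq (hopped_perm H)).
case: H us => u b v -> -> b0 bB hu hv us us' ys yx.
move: ys; rewrite mem_cat inE mem_cat (negbTE yx) /= => /or3P[] yin.
- case/splitPr: yin us us' hu => u1 u2.
  rewrite -!catA !cat_cons => us us' hu.
  have [yu _] := uniq_notin_cat us.
  rewrite !right_in_cat //.
  case: u2 hu us us' => [|z u2] //= hu us us'.
  case: b b0 bB us us' => [|c b] //= _ /andP[xc _] us us'.
  rewrite rev_cat /= in hu.
  (* Here [y] ends [u], and its right neighbour [x] is replaced by the first letter [c] of [b]. As
     [c] is inside both [x] and [y], these two are comparable, and [hu] rules out that [y] is inside
     [x]. *)
  apply/idP/idP => [yc|yx']; last exact: Btrans yx' xc.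
  by have := Bforest yc xc yx; rewrite (negbTE hu) orbF.
- case/splitPr: yin us us' bB {b0} => b1 b2.
  rewrite -!catA !cat_cons all_cat /= => us us' /and3P[_ xy _].
  have [yu _] : (y \notin u ++ x :: b1) /\ y \notin b2 ++ v.
    by apply: uniq_notin_cat; rewrite -catA.
  have [yu' _] : (y \notin u ++ b1) /\ y \notin b2 ++ x :: v.
    by apply: uniq_notin_cat; rewrite -catA.
  rewrite (_ : u ++ x :: b1 ++ _ = (u ++ x :: b1) ++ y :: b2 ++ v); last by rewrite -catA.
  rewrite catA !right_in_cat //.
  (* If [y] ends [b], its right neighbour changes from the first letter of [v] to [x]; neither is
     inside [y]. *)
  case: b2 {us us'} => [|z b2] //=; rewrite (Basym xy).
  case: v hv => //= c v hv; apply/esym/negbTE; apply: contra hv; exact: Btrans.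
- case/splitPr: yin us us' {hv} => v1 v2 us us'.
  have E1 : u ++ x :: b ++ v1 ++ y :: v2 = (u ++ x :: b ++ v1) ++ y :: v2.
    by rewrite -catA cat_cons -catA.
  have E2 : u ++ b ++ x :: v1 ++ y :: v2 = (u ++ b ++ x :: v1) ++ y :: v2.
    by rewrite -!catA.
  rewrite E1 in us *; rewrite E2 in us' *.
  have [yu _] := uniq_notin_cat us; have [yu' _] := uniq_notin_cat us'.
  by rewrite !right_in_cat.
Qed.

Lemma hopped_left x s s' y : uniq s -> hopped x s s' -> y \in s -> y != x ->
  left_in s' y = left_in s y.
Proof.
move=> us H ys yx; have pss := hopped_perm H.
rewrite -!right_in_rev //; last 2 first.
- by rewrite -(perm_uniq pss).
- by rewrite -(perm_mem pss).
apply/esym/(hopped_right (x := x)) => //; last by rewrite mem_rev -(perm_mem pss).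
  by rewrite rev_uniq -(perm_uniq pss).
exact: hopped_rev.
Qed.

Lemma hop_right_hopped x u v : head_in x v -> ~~ head_in x (rev u) ->
  hopped x (u ++ x :: v) (hop_right x u v).
Proof.
move=> hv hu; rewrite /hop_right; set n := find _ v.
apply: (@Hopped _ _ _ u (take n v) (drop n v)) => //.
- by rewrite cat_take_drop.
- by rewrite /n; case: v hv {n} => //= y v ->.
- apply/(all_nthP x) => i; rewrite size_take_min leq_min => /andP[i_n i_v].
  by rewrite nth_take //; have := before_find x i_n; move/negbFE.
- by rewrite /n; elim: v {hv n} => //= y v IH; case: ifP.
Qed.

(** The conditions in [hopped] make [find] stop exactly at the far end of [b], whether the block is
    read forwards or backwards. *)
Lemma hop_eq x s s' : uniq s -> hopped x s s' -> hop x s = s' /\ hop x s' = s.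
Proof.
move=> us H; have [rs _ rs' _] := hopped_self us H.
have us' : uniq s' by rewrite -(perm_uniq (hopped_perm H)).
have key u b v : b != [::] -> all (B x) b -> ~~ head_in x v ->
    hop_right x u (b ++ v) = u ++ b ++ x :: v.
  move=> _ bB hv; rewrite /hop_right find_cat.
  have -> : has (predC (B x)) b = false by apply/negbTE; rewrite has_predC bB.
  suff -> : find (predC (B x)) v = 0 by rewrite addn0 take_size_cat // drop_size_cat.
  by case: v hv => //= y v ->.
rewrite /hop rs (negbTE rs'); case: H us us' {rs rs'} => u b v -> -> b0 bB hu hv us us'.
have [xu _] := uniq_notin_cat us.
have [xub _] : (x \notin u ++ b) /\ x \notin v by apply: uniq_notin_cat; rewrite -catA.
rewrite take_index_cat // drop_index_cat // key //; split=> //.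
rewrite catA take_index_cat // drop_index_cat // rev_cat key //.
- by rewrite !rev_cat rev_cons !revK cat_rcons -catA.
- by rewrite -size_eq0 size_rev size_eq0.
- by rewrite all_rev.
Qed.

Definition unbalanced (s : seq X) (x : X) : bool := right_in s x != left_in s x.

Lemma hop_hopped x s : uniq s -> x \in s -> unbalanced s x ->
  hopped x s (hop x s) \/ hopped x (hop x s) s.
Proof.
move=> us xs; rewrite /unbalanced /hop; case/splitPr: xs us => u v us.
have [xu xv] := uniq_notin_cat us.
rewrite right_in_cat // left_in_cat // take_index_cat // drop_index_cat //.
case: ifP => [hv hu|hv hu].
  by left; apply: hop_right_hopped => //; rewrite eqb_id in hu.
right.
have /hopped_rev : hopped x (rev v ++ x :: rev u) (hop_right x (rev v) (rev u)).
  apply: hop_right_hopped; last by rewrite revK hv.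
  by move: hu; case: head_in.
by rewrite rev_cat rev_cons !revK cat_rcons.
Qed.

(** For a hop to the left, everything is read off the right hop that leads back from [hop x s] to
    [s]. *)
Lemma hop_spec x s : uniq s -> x \in s -> unbalanced s x ->
  [/\ perm_eq s (hop x s), hop x (hop x s) = s,
      right_in (hop x s) x = ~~ right_in s x,
      {in s, forall y, y != x -> right_in (hop x s) y = right_in s y} &
      {in s, unbalanced (hop x s) =1 unbalanced s}].
Proof.
move=> us xs fx; have [H|H] := hop_hopped us xs fx.
  have [r1 l1 r2 l2] := hopped_self us H; have [_ hK] := hop_eq us H.
  split=> //; first exact: hopped_perm H.
  - by rewrite r1 (negbTE r2).
  - by move=> y ys yx; rewrite (hopped_right us H).
  move=> y ys; rewrite /unbalanced; have [->|yx] := eqVneq y x.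
    by rewrite r1 l2 (negbTE l1) (negbTE r2).
  by rewrite (hopped_right us H) // (hopped_left us H).
have ps := hopped_perm H; have us' : uniq (hop x s) by rewrite (perm_uniq ps).
have [r1 l1 r2 l2] := hopped_self us' H; have [hK _] := hop_eq us' H.
split=> //; first by rewrite perm_sym.
- by rewrite r1 (negbTE r2).
- by move=> y ys yx; rewrite (hopped_right us' H) // (perm_mem ps).
move=> y ys; rewrite /unbalanced; have [->|yx] := eqVneq y x.
  by rewrite r1 l2 (negbTE l1) (negbTE r2).
by rewrite (hopped_right us' H) ?(hopped_left us' H) ?(perm_mem ps).
Qed.

End Hop.

(** * The rank function and linear extensions of a sign-graded poset *)

Section SignGraded.
Variables (T : finType) (le : rel T) (omega : T -> nat) (r : int).
Hypotheses (Hposet : is_poset le) (Hsg : sign_graded le omega r).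

Local Notation lt := (plt le).
Local Notation rho := (rho le omega).

Lemma plt_le x y : lt x y -> le x y. Proof. by case/andP. Qed.

Lemma plt_irr x : lt x x = false. Proof. by rewrite /plt eqxx. Qed.

Lemma plt_le_trans x y z : lt x y -> le y z -> lt x z.
Proof.
have [_ anti tr] := Hposet.
case/andP=> xy lxy lyz; rewrite /plt (tr _ _ _ lxy lyz) andbT.
by apply: contra xy => /eqP xz; apply/eqP/anti; rewrite lxy xz lyz.
Qed.

Lemma covers_plt x y : covers le x y -> lt x y. Proof. by case/andP. Qed.

Lemma exists_cover_above x y : lt x y -> exists2 z, covers le x z & le z y.
Proof.
have [rfl _ tr] := Hposet => xy.
pose P z := lt x z && le z y; have Py : P y by rewrite /P xy rfl.
(* Among the elements above [x] and weakly below [y], one with the fewest elements below it covers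
   [x]. *)
have [z /andP[xz zy] zmin] := arg_minnP (fun z => #|[pred w | lt w z]|) Py.
exists z => //; rewrite /covers xz; apply/existsP => -[w /andP[xw wz]].
have Pw : P w by rewrite /P xw (tr _ _ _ (plt_le wz) zy).
have := zmin w Pw; rewrite leqNgt => /negP; apply; apply: proper_card.
apply/properP; split.
  by apply/subsetP => v; rewrite !inE => vw; apply: plt_le_trans vw (plt_le wz).
by exists w; rewrite !inE ?plt_irr.
Qed.

Lemma exists_minimal_below y : exists2 x, minimal le x & le x y.
Proof.
have [rfl _ tr] := Hposet.
have Py : le y y by [].
have [x xy xmin] := arg_minnP (P := fun x => le x y) (fun z => #|[pred w | lt w z]|) Py.
exists x => //; apply/forallP => w; apply/implyP => wx; apply: contraT => wx'.
have ltwx : lt w x by rewrite /plt wx' wx.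
have := xmin w (tr _ _ _ wx xy); rewrite leqNgt => /negP; case; apply: proper_card.
apply/properP; split.
  by apply/subsetP => v; rewrite !inE => vw; apply: plt_le_trans vw wx.
by exists w; rewrite !inE ?plt_irr.
Qed.

Lemma exists_maximal_above x : exists2 y, maximal le y & le x y.
Proof.
have [rfl _ tr] := Hposet.
have Px : le x x by [].
have [y xy ymin] := arg_minnP (P := fun y => le x y) (fun z => #|[pred w | lt z w]|) Px.
exists y => //; apply/forallP => w; apply/implyP => yw; apply: contraT => yw'.
have ltyw : lt y w by rewrite /plt eq_sym yw' yw.
have := ymin w (tr _ _ _ xy yw); rewrite leqNgt => /negP; case; apply: proper_card.
apply/properP; split.
  by apply/subsetP => v; rewrite !inE => vw; apply: plt_le_trans ltyw (plt_le vw).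
by exists w; rewrite !inE ?plt_irr.
Qed.

Lemma exists_saturated_chain x y : le x y -> exists2 s, path (covers le) x s & last x s = y.
Proof.
have [rfl anti tr] := Hposet.
have [n] := ubnP #|[pred w | lt x w]|; elim: n x => // n IH x ltn lxy.
have [<-|xy] := eqVneq x y; first by exists [::].
have [|z xz zy] := @exists_cover_above x y; first by rewrite /plt xy.
have [|//|s sp sl] := IH z.
  rewrite -ltnS; apply: leq_trans ltn; rewrite ltnS; apply: proper_card; apply/properP; split.
    by apply/subsetP => v; rewrite !inE => zv; apply: plt_le_trans (covers_plt xz) (plt_le zv).
  by exists z; rewrite !inE ?plt_irr // covers_plt.
by exists (z :: s) => //=; rewrite xz.
Qed.

Lemma weight_cat x s1 s2 :
  weight omega x (s1 ++ s2) = (weight omega x s1 + weight omega (last x s1) s2)%R.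
Proof. by elim: s1 x => [|y s1 IH] x /=; rewrite ?add0r // IH addrA. Qed.

(** One fixed saturated chain from [z] to a maximal element completes every chain ending at [z] to a
    maximal chain of weight [r]. *)
Lemma rho_of_unique z j k : rho_of le omega z j -> rho_of le omega z k -> j = k.
Proof.
have [m mmax zm] := exists_maximal_above z.
have [s sp sl] := exists_saturated_chain zm.
have key i : rho_of le omega z i -> (i + weight omega z s)%R = r.
  case=> x0 [u [[min0 up ul] <-]].
  rewrite -(@Hsg x0 (u ++ s)) ?weight_cat ?ul //.
  by rewrite /maximal_chain min0 cat_path up last_cat ul sp sl.
by move=> /key jr /key; rewrite -jr => /addIr.
Qed.

Lemma rhoP z : rho_of le omega z (rho z).
Proof.
apply: epsilon_spec; have [m mmin mz] := exists_minimal_below z.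
by have [s sp sl] := exists_saturated_chain mz; exists (weight omega m s), m, s.
Qed.

Lemma rho_minimal z : minimal le z -> rho z = 0%R.
Proof. by move=> zmin; apply: (rho_of_unique (rhoP z)); exists z, [::]. Qed.

Lemma rho_maximal z : maximal le z -> rho z = r.
Proof.
move=> zmax; have [x0 [s [[min0 sp sl] <-]]] := rhoP z.
by apply: Hsg; rewrite /maximal_chain min0 sp sl.
Qed.

Lemma rho_covers x y : covers le x y -> rho y = (rho x + eps omega x y)%R.
Proof.
move=> xy; apply: (rho_of_unique (rhoP y)).
have [x0 [s [[min0 sp sl] <-]]] := rhoP x.
exists x0, (rcons s y); split; first by rewrite rcons_path sp sl last_rcons.
by rewrite -cats1 weight_cat sl /= addr0.
Qed.

Lemma rho_covers_neq x y : covers le x y -> rho x != rho y.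
Proof. by move=> /rho_covers ->; rewrite /eps; case: ifP => _; apply/eqP; lia. Qed.

(** Stated with [pairwise], so that it splits along concatenations. *)
Definition lin_extending (s : seq T) : bool := pairwise (fun x y => ~~ lt y x) s.

(* A cover of [x] below [y] would stand after [x] and not after [y], hence in [b],
   but [rho] changes along covers. *)
Lemma linear_antichain u b v x y : (forall z, z \in u ++ b ++ v) -> lin_extending (u ++ b ++ v) ->
  {in b &, forall z w, rho z = rho w} -> x \in b -> y \in b -> ~~ lt x y.
Proof.
move=> full; rewrite /lin_extending !pairwise_cat allrel_catr.
move=> /and3P[/andP[ub _] _ /and3P[bv _ _]] rb xb yb.
apply/negP => xy; have [z xz zy] := exists_cover_above xy.
have := full z; rewrite !mem_cat => /or3P[] zin.
- by have /negP := allrelP ub _ _ zin xb; apply; apply: covers_plt.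
- by have := rho_covers_neq xz; rewrite (rb x z) // eqxx.
- have [zy'|nzy] := eqVneq z y.
    by have := rho_covers_neq xz; rewrite (rb x z) ?zy' ?eqxx.
  by have /negP := allrelP bv _ _ yb zin; apply; rewrite /plt nzy zy.
Qed.

End SignGraded.

(** * Neighbours by position, descents, and sign-reversing involutions *)

Section Neighbours.
Variables (X : eqType) (B : rel X).

Lemma right_in_nth x0 s i : uniq s -> i < size s ->
  right_in B s (nth x0 s i) = (i.+1 < size s) && B (nth x0 s i) (nth x0 s i.+1).
Proof.
move=> us ltis; rewrite /right_in index_uniq //; case: ltnP => ltis1.
  by rewrite (drop_nth x0).
by rewrite drop_oversize.
Qed.

Lemma left_in_nth x0 s i : uniq s -> i < size s ->
  left_in B s (nth x0 s i) = (0 < i) && B (nth x0 s i) (nth x0 s i.-1).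
Proof.
move=> us ltis; rewrite /left_in index_uniq //; case: i ltis => [|i] ltis; first by rewrite take0.
by rewrite (take_nth x0) ?rev_rcons // ltnW.
Qed.

Lemma right_in_cons a s x : x != a -> right_in B (a :: s) x = right_in B s x.
Proof. by move=> xa; rewrite /right_in /= eq_sym (negbTE xa). Qed.

End Neighbours.

Lemma des_cons a b s : des (a :: b :: s) = (b < a) + des (b :: s).
Proof. by rewrite /des /= -[1]addn0 iotaDl count_map. Qed.

Lemma count_odd_iota n : count odd (iota 0 n) = n./2.
Proof. by elim: n => // n IH; rewrite -addn1 iotaD count_cat IH /=; lia. Qed.

(** Reindexing along [f] shows that the part of the sum off the fixed points equals its own
    negative. *)
Lemma sum_involution (X : finType) (P : pred X) (f : X -> X) (F : X -> int) :
  (forall x, P x -> P (f x)) -> (forall x, P x -> f (f x) = x) ->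
  (forall x, P x -> f x != x -> F (f x) = - F x)%R ->
  (\sum_(x | P x) F x = \sum_(x | P x && (f x == x)) F x)%R.
Proof.
move=> Pf ff Ff; rewrite (bigID (fun x => f x == x)) /=.
set S := (\sum_(x | P x && (f x != x)) F x)%R.
suff SN : S = (- S)%R by have -> : S = 0%R; [lia | rewrite addr0].
rewrite {1}/S (reindex_onto f f); last by move=> x /andP[Px _]; apply: ff.
rewrite -sumrN; apply: eq_big => [x|x /andP[/andP[Pfx nfx] /eqP ffx]].
  apply/andP/andP => [[/andP[Pfx nfx] /eqP ffx]|[Px nx]].
    by rewrite -ffx Pf // ffx eq_sym -{1}ffx.
  by rewrite Pf // ff // eqxx eq_sym nx.
have Px : P x by rewrite -ffx Pf.
by rewrite Ff // eq_sym -{1}ffx.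
Qed.

(** * Parity of the lengths of components *)

Section Components.
Variable f : nat -> int.
Hypothesis f01 : forall n, f n = 0%R \/ f n = 1%R.
Local Notation e n := (f n == 1%R).

Lemma f_eqE m n : (f m == f n) = (e m == e n).
Proof. by case: (f01 m) => ->; case: (f01 n) => ->. Qed.

Lemma components_cons a s : exists w ws, components f (a :: s) = (a :: w) :: ws.
Proof.
rewrite /=; case: components => [|[|b w] ws]; first by exists [::], [::].
  by exists [::], [::].
by case: ifP => _; [exists (b :: w), ws|exists [::], ((b :: w) :: ws)].
Qed.

(** Consecutive components have opposite values of [e], so [e a (+) e (last a s)] is the parity of
    the number of components after the first, each of which has odd length. *)
Lemma odd_size_components a s w ws : components f (a :: s) = w :: ws ->
  all (odd \o size) ws -> odd (size (a :: s)) = odd (size w) (+) e a (+) e (last a s).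
Proof.
elim: s a w ws => [|b s IH] a w ws; first by case=> <- _ _ /=; case: (e a).
have [u [us E]] := components_cons b s.
have -> : components f (a :: b :: s) =
    if f a == f b then (a :: b :: u) :: us else [:: a] :: (b :: u) :: us.
  by rewrite /= in E *; rewrite E.
rewrite f_eqE; case: ifP => [/eqP ab|ab] [<- <-] /=.
  by move=> /(IH _ _ _ E) /= ->; rewrite ab; case: (e b); case: odd; case: (e _).
move=> /andP[ou /(IH _ _ _ E) /= ->]; move: ou ab.
by case: (e a); case: (e b) => //=; case: odd => //=; case: (e _).
Qed.

(** Each component ends at a position [i] where [e] equals [q (+) odd i]. Since [e] changes between
    components, successive ends are an odd distance apart. Removing the first letter shifts
    positions by one, so the induction passes from [q] to [~~ q]. *)
Lemma components_odd (q : bool) a s w ws : components f (a :: s) = w :: ws ->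
  (forall i, i < size s -> f (nth 0 (a :: s) i) != f (nth 0 (a :: s) i.+1) ->
     e (nth 0 (a :: s) i) = q (+) odd i) ->
  e (last a s) = q (+) odd (size s) ->
  odd (size w) = (e a == q) /\ all (odd \o size) ws.
Proof.
elim: s q a w ws => [|b s IH] q a w ws.
  by case=> <- <- _ /= ->; rewrite addbF eqxx.
have [u [us E]] := components_cons b s.
have -> : components f (a :: b :: s) =
    if f a == f b then (a :: b :: u) :: us else [:: a] :: (b :: u) :: us.
  by rewrite /= in E *; rewrite E.
move=> EE C L.
have [||ou ous] := IH (~~ q) _ _ _ E.
- by move=> i ltis ne; rewrite (C i.+1 ltis ne) /= addbN addNb.
- by move: L; rewrite /= addbN addNb.
move: EE; case: ifP (C 0 isT) => [fab _|fab /(_ isT) /= ea] [<- <-]; rewrite f_eqE in fab.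
  split=> //; have -> : size [:: a, b & u] = (size (b :: u)).+1 by []; rewrite oddS ou (eqP fab).
  by case: q {IH C L ou ous}; case: (e b).
rewrite /= ea addbF eqxx; split=> //; rewrite ous andbT; move: ou => /= ->.
by move: fab; rewrite ea addbF; case: q {IH C L ous ea}; case: (e b).
Qed.

End Components.

(** * Canonical labelings and the relation [inside] *)

Section Canonical.
Variables (T : finType) (le : rel T) (omega : T -> nat) (r : int).
Hypotheses (Hposet : is_poset le) (Hlab : is_labeling omega) (Hne : 0 < #|T|).
Hypotheses (Hsg : sign_graded le omega r) (Hcan : canonical le omega).

Local Notation rho := (rho le omega).

Definition high (x : T) : bool := rho x == 1%R.

Definition inside (x y : T) : bool :=
  (high x == high y) && (if high x then omega x < omega y else omega y < omega x).

Lemma rho_eqE x y : (rho x == rho y) = (high x == high y).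
Proof.
by rewrite /high; case: Hcan => + _ => R; case: (R x) => ->; case: (R y) => ->.
Qed.

Lemma omega_neq x y : x != y -> omega x != omega y.
Proof. by apply: contra => /eqP /(proj1 Hlab) ->. Qed.

Lemma inside_irr : irreflexive inside.
Proof. by move=> x; rewrite /inside ltnn if_same andbF. Qed.

Lemma inside_trans : transitive inside.
Proof.
move=> y x z; rewrite /inside => /andP[/eqP <-] xy /andP[/eqP <-].
by rewrite eqxx; case: ifP xy => _; lia.
Qed.

Lemma inside_forest x y z : inside x z -> inside y z -> x != y -> inside x y || inside y x.
Proof.
rewrite /inside => /andP[/eqP hx _] /andP[/eqP hy _] /omega_neq.
by rewrite hx hy eqxx /=; case: ifP => _; lia.
Qed.

(** On one level of [rho] this is the definition of [inside]; between the two levels nothing is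
    inside, and canonicity gives the high element the larger label. *)
Lemma omega_gtE x y : x != y -> (omega y < omega x) = inside x y (+) high x.
Proof.
move=> /omega_neq nxy; rewrite /inside; have [e|ne] := eqVneq (high x) (high y).
  by rewrite /=; case: ifP => _; lia.
have [+ mono] := Hcan => R; move: ne (mono x y) (mono y x); rewrite /high.
case: (R x) => ->; case: (R y) => -> //= _.
  by move=> /(_ isT) + _; lia.
by move=> _ /(_ isT) ->.
Qed.

(** * Linear extensions as words, and the hopping involution on them *)

Definition linext (s : seq T) : Prop := [/\ uniq s, forall x, x \in s & lin_extending le s].

Lemma is_linextP (t : #|T|.-tuple T) : reflect (linext t) (is_linext le t).
Proof.
apply: (iffP andP) => [[ut /forallP lt_t]|[ut _ lin]]; split=> //.
- have /subset_cardP E : #|t| = #|predT : pred T| by rewrite (card_uniqP ut) size_tuple.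
  by move=> x; rewrite (E (subset_predT _)).
- have [x0 _|] := pickP (@predT T); last by move/eq_card0 => H; exfalso; move: Hne; rewrite H.
  apply/(pairwiseP x0) => i j; rewrite !inE size_tuple => lti ltj ltij.
  have /forallP/(_ (Ordinal lti)) := lt_t (Ordinal ltj).
  rewrite !(tnth_nth x0) /=; case: plt => //=; lia.
- apply/forallP => i; apply/forallP => j; apply/implyP => lij.
  rewrite ltnNge leq_eqVlt; apply/norP; split.
    by apply/eqP => /val_inj ji; move: lij; rewrite ji plt_irr.
  apply/negP => ji; move: lij; have [x0 _] : exists x : T, true by exists (tnth t i).
  rewrite !(tnth_nth x0).
  by apply/negP/(pairwiseP _ lin); rewrite ?inE ?size_tuple.
Qed.

(** A block with constant [rho] is an antichain, so its letters may be permuted freely. *)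
Lemma linear_swap u b c v : (forall x, x \in u ++ b ++ v) -> lin_extending le (u ++ b ++ v) ->
  {in b &, forall x y, rho x = rho y} -> perm_eq b c -> lin_extending le (u ++ c ++ v).
Proof.
move=> full lin rb bc.
have anti x y : x \in c -> y \in c -> ~~ plt le x y.
  rewrite -!(perm_mem bc) => xb yb; exact: (linear_antichain Hposet Hsg full lin rb).
move: lin; rewrite /lin_extending !pairwise_cat !allrel_catr.
move=> /and3P[/andP[ub ->] -> /and3P[bv _ ->]]; rewrite !andbT /=; apply/and3P; split.
- by apply/allrelP => x y xu yc; apply: (allrelP ub); rewrite ?(perm_mem bc).
- by apply/allrelP => x y xc yv; apply: (allrelP bv); rewrite ?(perm_mem bc).
- case: c bc anti => // x0 c bc anti; apply/(pairwiseP x0) => i j ltic ltjc _.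
  by apply: anti; apply: mem_nth.
Qed.

Lemma inside_rho x b : all (inside x) b -> {in x :: b &, forall y z, rho y = rho z}.
Proof.
move=> xb; have key y : y \in x :: b -> rho y = rho x.
  by rewrite inE => /orP[/eqP-> //|/(allP xb)] /andP[+ _]; rewrite -rho_eqE => /eqP.
by move=> y z /key -> /key ->.
Qed.

Lemma hop_linext s x : linext s -> unbalanced inside s x -> linext (hop inside x s).
Proof.
move=> [us full lin] fx.
have [ps _ _ _ _] := hop_spec inside_irr inside_trans inside_forest us (full x) fx.
split; [by rewrite -(perm_uniq ps)|by move=> y; rewrite -(perm_mem ps)|].
have [[u b v es es' _ bB _ _]|[u b v es' es _ bB _ _]] :=
  hop_hopped us (full x) fx.
- rewrite es' -cat_rcons; apply: (linear_swap (b := x :: b)); rewrite ?cat_cons -?es //.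
    exact: inside_rho.
  by rewrite perm_sym perm_rcons.
- have rc : rcons b x =i x :: b by move=> y; rewrite mem_rcons.
  rewrite es' -cat_cons; apply: (linear_swap (b := rcons b x)); rewrite ?cat_rcons -?es //.
    by move=> y z; rewrite !rc; apply: inside_rho.
  by rewrite perm_rcons.
Qed.

Definition hop_first (s : seq T) : seq T :=
  if [pick x | unbalanced inside s x] is Some x then hop inside x s else s.

Lemma hop_first_linext s : linext s -> linext (hop_first s).
Proof. by move=> ls; rewrite /hop_first; case: pickP => // x; apply: hop_linext. Qed.

(** A hop preserves the set of unbalanced letters, and [pick] depends only on this set, not on
    positions in the word; so the same letter hops back. *)
Lemma hop_firstK s : linext s -> hop_first (hop_first s) = s.
Proof.
move=> [us full _]; rewrite {2}/hop_first; case E: [pick x | _] => [x|]; last first.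
  by rewrite /hop_first E.
have fx : unbalanced inside s x by move: E; case: pickP => // y fy [<-].
have [_ hK _ _ fs] := hop_spec inside_irr inside_trans inside_forest us (full x) fx.
have Ef : unbalanced inside (hop inside x s) =1 unbalanced inside s by move=> y; rewrite fs.
by rewrite /hop_first (eq_pick Ef) E.
Qed.

(** * Descent parity under hops *)

Definition right_sign (s : seq T) : int := (\prod_(x : T) (-1) ^+ right_in inside s x)%R.

Lemma hop_first_sign s : linext s -> hop_first s != s ->
  right_sign (hop_first s) = (- right_sign s)%R.
Proof.
case=> us full _; rewrite /hop_first; case: pickP => [x fx _|_]; last by rewrite eqxx.
have [_ _ rx ry _] := hop_spec inside_irr inside_trans inside_forest us (full x) fx.
rewrite /right_sign (bigD1 x) // [in RHS](bigD1 x) //= rx -mulNr signrN; congr (_ * _)%R.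
by apply: eq_bigr => y yx; rewrite ry.
Qed.

(** A hop flips [right_in] at the hopping letter, hence always changes the word. *)
Lemma hop_first_fixed s : linext s -> (hop_first s == s) = [forall x, ~~ unbalanced inside s x].
Proof.
case=> us full _; rewrite /hop_first; case: pickP => [x fx|f0].
  have [_ _ rx _ _] := hop_spec inside_irr inside_trans inside_forest us (full x) fx.
  apply/eqP/forallP => [E|/(_ x)]; last by rewrite fx.
  by move: rx; rewrite E; case: right_in.
by rewrite eqxx; apply/esym/forallP => x; rewrite f0.
Qed.

(** By [omega_gtE], a letter other than the last is followed by a descent iff its [right_in] and
    [high] differ. The last letter has no right neighbour, so it contributes only its [high] sign,
    which the factor in front cancels. *)
Lemma des_sign_cons x s : uniq (x :: s) ->
  ((-1) ^+ des (map omega (x :: s)) = (-1) ^+ high (last x s) *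
   \prod_(y <- x :: s) ((-1) ^+ high y * (-1) ^+ right_in inside (x :: s) y) :> int)%R.
Proof.
elim: s x => [|b s IH] a us.
  by rewrite big_seq1 /right_in drop_oversize /= ?index_mem ?inE // mulr1 -expr2 sqrr_sign.
have ab : a != b by apply: contraTneq us => ->; rewrite /= inE eqxx.
have /andP[as_ us'] := us; rewrite [map _ _]/= des_cons exprD [X in (_ * X)%R]IH //=.
rewrite [in RHS]big_cons [RHS]mulrCA omega_gtE // signr_addb.
have -> : right_in inside [:: a, b & s] a = inside a b by rewrite /right_in /= eqxx.
rewrite [((-1) ^+ inside a b * _)%R]mulrC; congr (_ * (_ * _))%R.
rewrite !big_seq; apply: eq_bigr => y yin; rewrite (@right_in_cons _ _ a) //.
by apply: contraNneq as_ => <-.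
Qed.

Definition des_sign (s : seq T) : int := ((-1) ^+ des (map omega s))%R.

Lemma linext_last x s : linext (x :: s) -> high (last x s) = (r == 1%R).
Proof.
case=> us full; rewrite /lin_extending; move: us full; rewrite lastI.
set z := last x s; set u := belast x s => us full; rewrite pairwise_rcons => /andP[zmax _].
rewrite /high (rho_maximal Hposet Hsg) //; apply/forallP => y; apply/implyP => zy.
apply: contraT => yz; have := full y; rewrite mem_rcons inE (negbTE yz) /=.
by move=> /(allP zmax); rewrite /plt eq_sym yz zy.
Qed.

Lemma linext_head x s : linext (x :: s) -> high x = false.
Proof.
case=> us full /andP[xmin _].
rewrite /high (rho_minimal Hposet Hsg) //; apply/forallP => y; apply/implyP => yx.
apply: contraT => yx'; have := full y; rewrite inE (negbTE yx') /=.
by move=> /(allP xmin); rewrite /plt yx' yx.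
Qed.

Lemma linext_cons s : linext s -> exists x u, s = x :: u.
Proof.
case=> _ full _; have [x _|] := pickP (@predT T); last first.
  by move/eq_card0 => H; exfalso; move: Hne; rewrite H.
by case: s full => [/(_ x)//|y u _]; exists y, u.
Qed.

Lemma linext_perm_enum s : linext s -> perm_eq s (enum T).
Proof.
case=> us full _; apply: uniq_perm (enum_uniq _) _ => // x.
by rewrite mem_enum full.
Qed.

Lemma linext_size s : linext s -> size s = #|T|.
Proof. by move=> ls; rewrite (perm_size (linext_perm_enum ls)) -cardE. Qed.

(** The last letter is a maximal element, where [rho] is [r]; thus only the factor [right_sign s]
    varies with [s]. *)
Lemma des_signE s : linext s ->
  (des_sign s = (-1) ^+ (r == 1) * (\prod_x (-1) ^+ high x) * right_sign s)%R.
Proof.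
move=> ls; have [x [u Es]] := linext_cons ls; have us : uniq s by case: ls.
rewrite /des_sign -mulrA /right_sign -big_split /= -[RHS]/(_ * _)%R.
rewrite -[X in (_ * X)%R]big_enum /= -(perm_big _ (linext_perm_enum ls)) /=.
by subst s; rewrite des_sign_cons // linext_last.
Qed.

Lemma hop_first_des_sign s : linext s -> hop_first s != s ->
  des_sign (hop_first s) = (- des_sign s)%R.
Proof.
move=> ls nf; rewrite !des_signE //; last exact: hop_first_linext.
by rewrite hop_first_sign // mulrN.
Qed.

(** * Fixed points of the involution *)

Definition alternates x0 (s : seq T) : Prop :=
  forall i, i.+1 < size s -> (omega (nth x0 s i.+1) < omega (nth x0 s i)) = odd i.

Lemma rev_alternatingP x0 s : uniq s -> rev_alternating (map omega s) <-> alternates x0 s.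
Proof.
move=> us; have neq i : i.+1 < size s -> omega (nth x0 s i) != omega (nth x0 s i.+1).
  by move=> lti; apply: omega_neq; rewrite nth_uniq //; lia.
rewrite /rev_alternating size_map; split=> [/allP A i lti|A].
  have := A i; rewrite mem_iota add0n !(nth_map x0) //; last lia.
  by move: (neq i lti); case: odd => /=; lia.
apply/allP => i; rewrite mem_iota add0n => /andP[_ lti].
have lti' : i.+1 < size s by rewrite -ltn_predRL.
rewrite !(nth_map x0) ?(ltnW lti') //.
by move: (neq i lti') (A i lti'); case: odd => /=; lia.
Qed.

Lemma alternates_des x0 s : alternates x0 s -> des (map omega s) = (size s).-1./2.
Proof.
move=> A; rewrite /des size_map -count_odd_iota; apply: eq_in_count => i.
rewrite mem_iota add0n => /andP[_ lti].
by rewrite !(nth_map x0) ?A //; lia.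
Qed.

Lemma linext_nth0 x0 s : linext s -> high (nth x0 s 0) = false.
Proof. by move=> ls; have [x [u Es]] := linext_cons ls; subst s; apply: linext_head ls. Qed.

Lemma linext_nth_last x0 s : linext s -> high (nth x0 s (size s).-1) = (r == 1%R).
Proof.
move=> ls; have [x [u Es]] := linext_cons ls; subst s.
by rewrite nth_last; apply: linext_last ls.
Qed.

(** [omega_gtE] for an adjacent pair in both orders: it ties the right side of a letter to the left
    side of the next one. *)
Lemma omega_gt_nth x0 s i : uniq s -> i.+1 < size s ->
  let gt := omega (nth x0 s i.+1) < omega (nth x0 s i) in
  gt = right_in inside s (nth x0 s i) (+) high (nth x0 s i) /\
  gt = ~~ (left_in inside s (nth x0 s i.+1) (+) high (nth x0 s i.+1)).
Proof.
move=> us lti; have nn : nth x0 s i != nth x0 s i.+1 by rewrite nth_uniq //; lia.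
rewrite right_in_nth //; last lia.
rewrite left_in_nth // lti /= -!omega_gtE //; last by rewrite eq_sym.
by split=> //; rewrite [LHS]ltnNge [in RHS]ltn_neqAle omega_neq.
Qed.

(** If the two sides of each letter agree, [omega_gt_nth] makes successive comparisons opposite. The
    first is an ascent, since the first letter is low and has no left neighbour; the last letter,
    without right neighbour, gives the parity. Conversely, both sides of the letter at [i] equal
    [odd i (+) high]. *)
Lemma balanced_alternates x0 s : linext s ->
  [forall x, ~~ unbalanced inside s x] <->
  alternates x0 s /\ odd (size s).-1 = (r == 1%R).
Proof.
move=> ls; have us : uniq s by case: ls.
have s0 : 0 < size s by rewrite linext_size.
rewrite -(linext_nth_last x0 ls); split=> [/forallP bal|[A L]].
  have {}bal x : left_in inside s x = right_in inside s x.
    by have := bal x; rewrite /unbalanced negbK => /eqP.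
  have A : alternates x0 s.
    elim=> [|i IH] lti.
      have [-> _] := omega_gt_nth x0 us lti.
      by rewrite (linext_nth0 x0 ls) -bal left_in_nth.
    have [-> _] := omega_gt_nth x0 us lti.
    rewrite /= -IH; last lia.
    have [_ ->] := omega_gt_nth x0 us (ltnW lti).
    by rewrite bal negbK.
  split=> //; case E : (size s).-1 => [|n]; first by rewrite (linext_nth0 x0 ls).
  have ltn : n.+1 < size s by lia.
  have [_] := omega_gt_nth x0 us ltn; rewrite A // bal right_in_nth //.
  have -> : n.+2 < size s = false by lia.
  by rewrite /= => ->; rewrite negbK.
apply/forallP => x; rewrite /unbalanced negbK; apply/eqP.
have full : x \in s by case: ls.
rewrite -(nth_index x0 full); set i := index x s.
have lti : i < size s by rewrite index_mem.
have R : right_in inside s (nth x0 s i) = odd i (+) high (nth x0 s i).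
  have [lti1|lei] := ltnP i.+1 (size s).
    by have [+ _] := omega_gt_nth x0 us lti1; rewrite A // => ->; rewrite addbK.
  (* The last letter has no right neighbour; there [L] makes [odd i (+) high] false. *)
  have Ei : i = (size s).-1 by apply/eqP; rewrite eqn_leq -ltnS prednK // lti -ltnS prednK.
  by rewrite right_in_nth // ltnNge lei /= Ei L addbb.
rewrite R; case: i lti {R} => [|i] lti.
  by rewrite left_in_nth //= linext_nth0.
have [_] := omega_gt_nth x0 us lti; rewrite A //= => ->.
by rewrite negbK addbK.
Qed.

Lemma rho_letter_omega x : rho_letter le omega (omega x) = rho x.
Proof.
rewrite /rho_letter; case: pickP => [y /eqP /(proj1 Hlab) -> //|/(_ x)].
by rewrite eqxx.
Qed.

Lemma rho_letter01 n : rho_letter le omega n = 0%R \/ rho_letter le omega n = 1%R.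
Proof. by rewrite /rho_letter; case: pickP => [y _|_]; [apply: (proj1 Hcan)|left]. Qed.

(** The value of [rho] is 0 at the first letter and [r] at the last, which fixes the parity of the
    number of components. This excludes all counted words when [p - 1 - r] is odd. *)
Lemma odd_components_parity s : linext s ->
  odd_components (rho_letter le omega) (map omega s) -> odd (size s).-1 = (r == 1%R).
Proof.
move=> ls; have [x [u Es]] := linext_cons ls; subst s.
rewrite /odd_components map_cons.
have [w [ws E]] := components_cons (rho_letter le omega) (omega x) (map omega u).
rewrite E => /andP[ow ows].
have := odd_size_components rho_letter01 E ows; rewrite ow last_map !rho_letter_omega.
rewrite -/(high x) (linext_head ls) -/(high (last x u)) (linext_last ls).
by rewrite /= size_map => /negbRL ->; rewrite negbK.
Qed.

(** At a border the right neighbour is not inside, so [high] there equals the descent indicator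
    [odd i]: this is the condition of [components_odd] with [q := false]. *)
Lemma alternates_odd_components x0 s : linext s -> alternates x0 s ->
  odd (size s).-1 = (r == 1%R) -> odd_components (rho_letter le omega) (map omega s).
Proof.
move=> ls; have us : uniq s by case: ls.
have [x [u Es]] := linext_cons ls; subst s => A L.
rewrite /odd_components map_cons.
have [w [ws E]] := components_cons (rho_letter le omega) (omega x) (map omega u).
rewrite E /=.
have nthE j : j < size (x :: u) ->
    nth 0 (omega x :: map omega u) j = omega (nth x0 (x :: u) j).
  by move=> ltj; rewrite -map_cons (nth_map x0).
have [||] := components_odd rho_letter01 (q := false) E.
- move=> i; rewrite size_map => ltiu; have lti : i.+1 < size (x :: u) by [].
  rewrite !nthE ?(ltnW lti) // !rho_letter_omega rho_eqE => ne.
  have [+ _] := omega_gt_nth x0 us lti; rewrite A // => ->.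
  by rewrite right_in_nth ?(ltnW lti) // /inside (negbTE ne) andbF.
- by rewrite last_map rho_letter_omega size_map -/(high _) (linext_last ls) -L.
- by rewrite rho_letter_omega -/(high x) (linext_head ls) eqxx /= => -> ->.
Qed.

Lemma hop_first_fixedE s : linext s -> odd #|T|.-1 = (r == 1%R) ->
  (hop_first s == s) =
  rev_alternating (map omega s) && odd_components (rho_letter le omega) (map omega s).
Proof.
move=> ls; rewrite -(linext_size ls) hop_first_fixed // => par.
have us : uniq s by case: ls.
have [x0 _] := linext_cons ls.
apply/idP/andP => [/(balanced_alternates x0 ls)[A _]|[/(rev_alternatingP x0 us) A _]].
  by split; [apply/(rev_alternatingP x0 us)|apply: alternates_odd_components A par].
exact/(balanced_alternates x0 ls).
Qed.

(** * Sums over the permutations of linear extensions *)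

Lemma big_Lperm (V : nmodType) (F : seq nat -> V) :
  (\sum_(pi <- Lperm le omega) F pi =
   \sum_(t : #|T|.-tuple T | is_linext le t) F (map omega t))%R.
Proof.
(* Injectivity of [omega] gives distinct words to distinct tuples. *)
rewrite /Lperm undup_id; first by rewrite big_map big_filter big_enum_cond.
rewrite map_inj_uniq => [|t u /(inj_map (proj1 Hlab)) /val_inj //].
by apply: filter_uniq; apply: enum_uniq.
Qed.

Lemma W_minus1 : ((W le omega).[-1] =
  \sum_(t : #|T|.-tuple T | is_linext le t) des_sign t)%R.
Proof. by rewrite /W horner_sum big_Lperm; apply: eq_bigr => t _; rewrite hornerXn. Qed.

Lemma count_Lperm (a : pred (seq nat)) : (Posz (count a (Lperm le omega)) =
  \sum_(t : #|T|.-tuple T | is_linext le t && a (map omega t)) 1)%R.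
Proof.
rewrite -sum1_count big_mkcond /= -[Posz _]natz natr_sum big_Lperm [RHS]big_mkcondr /=.
by apply: eq_bigr => t _; case: ifP.
Qed.

Lemma sum_des_sign : odd #|T|.-1 = (r == 1%R) ->
  (\sum_(t : #|T|.-tuple T | is_linext le t) des_sign t =
   \sum_(t : #|T|.-tuple T | is_linext le t &&
     (rev_alternating (map omega t) && odd_components (rho_letter le omega) (map omega t)))
     (-1) ^+ #|T|.-1./2)%R.
Proof.
move=> par; pose f (t : #|T|.-tuple T) := insubd t (hop_first t).
have fE t : is_linext le t -> val (f t) = hop_first t.
  by move=> /is_linextP /hop_first_linext /linext_size /eqP st; rewrite val_insubd st.
have fL t : is_linext le t -> is_linext le (f t).
  by move=> lt; apply/is_linextP; rewrite fE //; apply/hop_first_linext/is_linextP.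
rewrite (sum_involution (f := f)) //.
- apply: eq_big => [t|t /andP[/is_linextP lt]].
    have [lt|//] := boolP (is_linext le t).
    by rewrite /= -val_eqE /= fE // hop_first_fixedE //; apply/is_linextP.
  rewrite -val_eqE /= fE; last exact/is_linextP.
  rewrite hop_first_fixedE // => /andP[ra _].
  have [x0 _] := linext_cons lt; have us : uniq t by case: lt.
  by rewrite /des_sign (alternates_des (proj1 (rev_alternatingP x0 us) ra)) size_tuple.
- by move=> t lt; apply: val_inj; rewrite fE ?fL // fE // hop_firstK //; apply/is_linextP.
- move=> t lt; rewrite -val_eqE /= fE // => nf.
  by apply: hop_first_des_sign => //; apply/is_linextP.
Qed.

End Canonical.

(** * The Charney-Davis quantity *)

Theorem theorem5p2 (T : finType) (le : rel T) (omega : T -> nat) (r : int)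
  (Hposet : is_poset le) (Hlab : is_labeling omega) (Hne : (0 < #|T|)%N)
  (Hsg : sign_graded le omega r) (Hcan : canonical le omega) :
  CD le omega r =
  Posz (count (fun pi => rev_alternating pi && odd_components (rho_letter le omega) pi)
              (Lperm le omega)).
Proof.
(* [r] is the value of [rho] at a maximal element. *)
have r01 : r = 0%R \/ r = 1%R.
  have /card_gt0P[x _] := Hne; have [y ymax _] := exists_maximal_above Hposet x.
  by rewrite -(rho_maximal Hposet Hsg ymax); apply: (proj1 Hcan).
rewrite count_Lperm // /CD; set m := absz _.
have mE : odd m = (odd #|T|.-1 != (r == 1%R)).
  by rewrite /m; case: r01 => ->; move: Hne; move: #|T| => p /=; lia.
case: ifPn => om.
  (* For odd [m] both sides vanish: all components odd would force the other parity. *)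
  rewrite big1 // => t /andP[/(is_linextP le Hne) lt /andP[_ oc]].
  have /eqP := odd_components_parity Hposet Hlab Hne Hsg Hcan lt oc.
  by rewrite size_tuple; apply: contraTeq; rewrite -mE om.
have par : odd #|T|.-1 = (r == 1%R) by apply/eqP; move: om; rewrite mE negbK.
rewrite W_minus1 // (sum_des_sign Hposet Hlab Hne Hsg Hcan par) mulr_sumr; apply: eq_bigr => t _.
(* By [par], [r] is the remainder of [p - 1] modulo 2. The sign in [CD] is therefore the sign of
   every surviving term, and the two cancel. *)
have -> : (m %/ 2)%N = #|T|.-1./2.
  by move: par; rewrite /m; case: r01 => ->; move: Hne; move: #|T| => p /=; lia.
by rewrite -expr2 sqrr_sign.
Qed.
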